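(* Let $X$ be a compact Hausdorff space, $A=C(X)$, $T:X\to X$ a local homeomorphism such that $\alpha:A\to A$, $\alpha(a)=a\circ T$, is an injective endomorphism. Let $L:A\to A$ be a normalized transfer operator for $\alpha$ such that the conditional expectation $E=\alpha\circ L:A\to\alpha(A)$ has finite index, let $C^*(\mathcal{R},\mathcal{E})$ be the associated C*-algebra and $G:C^*(\mathcal{R},\mathcal{E})\to A$ its canonical conditional expectation. Let $h\in A$ be strictly positive and $\beta\in\mathbb{R}$, and suppose that $\psi=\phi\circ G$, with $\phi$ a state on $A$, is an $(h,\beta)$-KMS state of $C^*(\mathcal{R},\mathcal{E})$. Let $\rho=h^{-\beta}$ and suppose that $L_\rho(k)=\lambda k$ for some $\lambda>0$ and some strictly positive $k\in A$, where $L_\rho(a)(x)=\sum_{T(y)=x}\rho(y)a(y)$. Put $\widetilde{\rho}=\dfrac{\rho k}{\lambda\alpha(k)}$ and let $\widetilde{\phi}$ be the state of $A$ given by $\widetilde{\phi}(a)=\phi(ka)$ (so $k$ is normalized by $\phi(k)=1$). If $$\lim_{n\to\infty}\left\|L_{\widetilde{\rho}}^n(a)-\widetilde{\phi}(a)\right\|=0\quad\text{for all }a\in A,$$ then $\widetilde{\phi}$ is an equilibrium state for $\widetilde{\rho}$.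
   Context: States: a state on a unital C*-algebra is a positive linear functional with value $1$ at the unit. In the displayed limit the scalar $\widetilde\phi(a)$ is identified with the constant function $\widetilde\phi(a)1\in A$, and the norm is the supremum norm. Transfer operators: a transfer operator for $\alpha$ is a positive linear map $L:A\to A$ with $L(\alpha(a)b)=aL(b)$ for all $a,b\in A$; it is normalized if $L(1)=1$. Since $T$ is a local homeomorphism, every transfer operator is of the form $L_{\rho}(a)(x)=\sum_{T(y)=x}\rho(y)a(y)$ with $\rho:X\to[0,\infty)$ continuous. Finite index: $E=\alpha\circ L$ has finite index if there is a finite family $u_1,\dots,u_m\in A$ with $a=\sum_i u_iE(u_i^*a)$ for all $a\in A$; then $\mathrm{ind}(E)=\sum_i u_iu_i^*$ (independent of the family, and invertible). The algebra $C^*(\mathcal{R},\mathcal{E})$: for $n\geq0$ let $E_n=\alpha^n\circ L^n:A\to\alpha^n(A)$ (the relevant equivalence relation is $x\sim y$ iff $T^n(x)=T^n(y)$ for some $n\in\mathbb{N}$). Let $\mathcal{T}(\mathcal{R},\mathcal{E})$ be the universal unital C*-algebra generated by a copy of $A$ and projections $e_0,e_1,e_2,\dots$ subject to $e_0=1$, $e_{n+1}e_n=e_{n+1}$, and $e_nae_n=E_n(a)e_n$ for all $a\in A$, $n\ge0$. Let $\widehat{\mathcal{K}}_n$ be the closed linear span of $Ae_nA$. A redundancy is a finite sequence $(a_0,\dots,a_n)$ with $a_i\in\widehat{\mathcal{K}}_i$ and $\sum_{i=0}^na_ix=0$ for all $x\in\widehat{\mathcal{K}}_n$. Then $C^*(\mathcal{R},\mathcal{E})$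 is the quotient of $\mathcal{T}(\mathcal{R},\mathcal{E})$ by the closed two-sided ideal generated by the sums $a_0+\dots+a_n$ over all redundancies; $A$ embeds in it. The canonical conditional expectation $G:C^*(\mathcal{R},\mathcal{E})\to A$ is determined by $G(ae_nb)=a\,I_n^{-1}\,b$ for $a,b\in A$, $n\ge0$, where $I_n=\prod_{i=0}^{n-1}\alpha^i(\mathrm{ind}(E))$. KMS states: $h$ determines the one-parameter group of automorphisms $\sigma$ of $C^*(\mathcal{R},\mathcal{E})$ with $\sigma_t(a)=a$ for $a\in A$ and $\sigma_t(e_n)=(h^{[n]})^{it}e_n(h^{[n]})^{-it}$, where $h^{[n]}=\prod_{i=0}^{n-1}\alpha^i(h)$. An $(h,\beta)$-KMS state is a state $\psi$ such that $\psi(xy)=\psi(y\,\sigma_{i\beta}(x))$ for all $y$ and all analytic $x$ (those for which $t\mapsto\sigma_t(x)$ extends analytically to $\mathbb{C}$). Entropy, pressure, equilibrium states: let $A_+$ be the set of strictly positive functions in $A$ (spectrum contained in $(0,\infty)$). For a state $\phi$ on $A$, $$\mathrm{Ent}(\phi)=\inf_{a\in A_+}\phi\left(\ln\left(\frac{L_{\rho_0}(a)}{\rho_0\,a}\right)\right),$$ where $\rho_0:X\to(0,\infty)$ is any continuous function; the value does not depend on $\rho_0$. A state $\phi$ on $A$ is $\alpha$-invariant if $\phi\circ\alpha=\phi$. For $b\in A_+$ the pressure is $p(b)=\sup\{\mathrm{Ent}(\phi)+\phi(\ln b):\phi\ \alpha\text{-invariant state on }A\}$, and an equilibrium state for $b$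 is an $\alpha$-invariant state $\phi$ with $\mathrm{Ent}(\phi)+\phi(\ln b)=p(b)$. *)

(* Defs.v *)
From HB Require Import structures.
From mathcomp Require Import all_boot all_order all_algebra.
From mathcomp Require Import finmap.
From mathcomp Require Import all_classical all_reals all_analysis.
From mathcomp Require Import complex.
Set Implicit Arguments.
Unset Strict Implicit.
Unset Printing Implicit Defensive.
Import Order.TTheory GRing.Theory Num.Theory.
Import numFieldNormedType.Exports.
Local Open Scope classical_set_scope.
Local Open Scope ring_scope.

(* The complex numbers, sealed as a [numClosedFieldType]: the analysis library
   then equips them with their topology and with the structure of a normed
   module over themselves, which the bare type [R[i]] does not get. *)
Definition Cx (R : realType) : numClosedFieldType := R[i].
Definition ReC {R : realType} (z : Cx R) : R := complex.Re z.
Definition ofR {R : realType} (r : R) : Cx R := real_complex R r.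

(* Unital *-algebras over the complex numbers (the zero algebra included).
   Multiplication is a field of the mixin because a structure joining a ring
   with a normed module cannot be declared above [numDomainType]; the ring
   structure, hence [1], [*] and [\prod], is recovered below. *)
HB.mixin Record isStarAlgebra (R : realType) B & GRing.Lmodule (Cx R) B := {
  amul : B -> B -> B;
  aone : B;
  amulA : associative amul;
  amul1l : left_id aone amul;
  amul1r : right_id aone amul;
  amulDl : left_distributive amul +%R;
  amulDr : right_distributive amul +%R;
  amulZl : forall (c : Cx R) (x y : B), amul (c *: x) y = c *: amul x y;
  amulZr : forall (c : Cx R) (x y : B), amul x (c *: y) = c *: amul x y;
  star : B -> B;
  starK : involutive star;
  starD : {morph star : x y / x + y};
  starZ : forall (c : Cx R) (x : B), star (c *: x) = c^* *: star x;
  starM : forall x y : B, star (amul x y) = amul (star y) (star x)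
}.

#[short(type="starAlgType")]
HB.structure Definition StarAlgebra (R : realType) :=
  {B of GRing.Lmodule (Cx R) B & isStarAlgebra R B}.

HB.mixin Record isCstarAlgebra (R : realType) B
    & StarAlgebra R B & CompleteNormedModule (Cx R) B := {
  cstar_normM : forall x y : B, `|amul x y| <= `|x| * `|y|;
  cstar_normE : forall x : B, `|amul (star x) x| = `|x| ^+ 2
}.

#[short(type="cstarAlgType")]
HB.structure Definition CstarAlgebra (R : realType) :=
  {B of StarAlgebra R B & CompleteNormedModule (Cx R) B & isCstarAlgebra R B}.

#[non_forgetful_inheritance]
HB.instance Definition _ (R : realType) (B : starAlgType R) :=
  GRing.Zmodule_isPzRing.Build B (@amulA R B) (@amul1l R B) (@amul1r R B)
    (@amulDl R B) (@amulDr R B).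
#[non_forgetful_inheritance]
HB.instance Definition _ (R : realType) (B : cstarAlgType R) :=
  GRing.Zmodule_isPzRing.Build B (@amulA R B) (@amul1l R B) (@amul1r R B)
    (@amulDl R B) (@amulDr R B).

Section complex_continuity.
Context {R : realType}.

Lemma normr_ReC (z : Cx R) : ofR `|ReC z| <= `|z|.
Proof.
case: z => a b; rewrite [X in _ <= X]normc_def /= /ofR lecR /= -sqrtr_sqr.
by rewrite ler_wsqrtr// lerDl sqr_ge0.
Qed.

Lemma ReCB (y z : Cx R) : ReC (y - z) = ReC y - ReC z.
Proof. by case: y z => [a b] [c d]. Qed.

Lemma ReC_gt0 (z : Cx R) : 0 < z -> 0 < ReC z /\ z = ofR (ReC z).
Proof.
case: z => a b; rewrite /ReC /= ltcE /= => /andP[/eqP b0 a0]; split => //.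
by move: b0 => ->.
Qed.

Lemma ReC_ge0 (z : Cx R) : 0 <= z -> 0 <= ReC z /\ z = ofR (ReC z).
Proof.
case: z => a b; rewrite /ReC /= lecE /= => /andP[/eqP b0 a0]; split => //.
by move: b0 => ->.
Qed.

Lemma ofRM (r s : R) : ofR (r * s) = ofR r * ofR s.
Proof. exact: (rmorphM (real_complex R)). Qed.

Lemma conjC_ofR (r : R) : (ofR r)^* = ofR r.
Proof. exact: conjc_real. Qed.

Lemma near_dist (z e : Cx R) : 0 < e -> \forall y \near z, `|z - y| < e.
Proof.
by move=> e0; exact: (@cvgr_dist_lt _ _ _ _ (nbhs_filter z) id).
Qed.

Lemma continuous_ReC : continuous (@ReC R).
Proof.
move=> z; apply/(@cvgrPdist_lt _ _ _ _ (nbhs_filter z)) => e e0.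
have e0' : (0 : Cx R) < ofR e by rewrite /ofR ltcR.
apply: (@filterS _ (nbhs z)) (near_dist z e0') => y h.
by have := le_lt_trans (normr_ReC (z - y)) h; rewrite /ofR ltcR ReCB.
Qed.

Lemma continuous_ofR : continuous (@ofR R).
Proof.
move=> r; apply/(@cvgrPdist_lt _ _ _ _ (nbhs_filter r)) => e e0.
have [e0' eE] := ReC_gt0 e0.
have H : \forall s \near r, `|r - s| < ReC e.
  exact: (@cvgr_dist_lt _ _ _ _ (nbhs_filter r) id).
apply: (@filterS _ (nbhs r)) H => s h.
have -> : `|ofR r - ofR s| = ofR `|r - s|.
  by rewrite /ofR -rmorphB/= normc_def /= expr0n/= addr0 sqrtr_sqr.
by rewrite eE /ofR ltcR.
Qed.

Lemma continuous_conjC : continuous (fun z : Cx R => z^*).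
Proof.
move=> z; apply/(@cvgrPdist_lt _ _ _ _ (nbhs_filter z)) => e e0.
apply: (@filterS _ (nbhs z)) (near_dist z e0) => y h.
by rewrite -rmorphB norm_conjC.
Qed.

End complex_continuity.

Notation cfun R X := (continuousType X (Cx R)).

Section cfun_algebra.
Context {R : realType} {X : topologicalType}.
Local Notation C := (Cx R).
Local Notation A := (cfun R X).
Implicit Types (a b : A) (c : C).

Lemma cfunP a b : (forall x, a x = b x) -> a = b.
Proof. by move=> ab; apply/continuousEP. Qed.

Let cstC c : continuous (fun _ : X => c).
Proof. by move=> x; exact: cvg_cst. Qed.
Let addC a b : continuous (fun x => a x + b x).
Proof. by move=> x; apply: cvgD; exact: cts_fun. Qed.
Let oppC a : continuous (fun x => - a x).
Proof. by move=> x; apply: cvgN; exact: cts_fun. Qed.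
Let mulC a b : continuous (fun x => a x * b x).
Proof. by move=> x; apply: cvgM; exact: cts_fun. Qed.
Let starC a : continuous (fun x => (a x)^*).
Proof.
by move=> x; apply: (@continuous_comp _ _ _ a (fun z : C => z^*));
  [exact: cts_fun|exact: continuous_conjC].
Qed.

Let ccst c : A := mkcts (@cstC c).
Let cadd a b : A := mkcts (@addC a b).
Let copp a : A := mkcts (@oppC a).
Let cmul a b : A := mkcts (@mulC a b).
Let cstar a : A := mkcts (@starC a).
Let cscale c a : A := cmul (ccst c) a.

Fact cfun_addA : associative cadd.
Proof. by move=> a b d; apply: cfunP => x /=; exact: addrA. Qed.
Fact cfun_addC : commutative cadd.
Proof. by move=> a b; apply: cfunP => x /=; exact: addrC. Qed.
Fact cfun_add0 : left_id (ccst 0) cadd.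
Proof. by move=> a; apply: cfunP => x /=; exact: add0r. Qed.
Fact cfun_addN : left_inverse (ccst 0) copp cadd.
Proof. by move=> a; apply: cfunP => x /=; exact: addNr. Qed.
HB.instance Definition _ := GRing.isZmodule.Build A
  cfun_addA cfun_addC cfun_add0 cfun_addN.

Fact cfun_mulA : associative cmul.
Proof. by move=> a b d; apply: cfunP => x /=; exact: mulrA. Qed.
Fact cfun_mulC : commutative cmul.
Proof. by move=> a b; apply: cfunP => x /=; exact: mulrC. Qed.
Fact cfun_mul1 : left_id (ccst 1) cmul.
Proof. by move=> a; apply: cfunP => x /=; exact: mul1r. Qed.
Fact cfun_mulDl : left_distributive cmul +%R.
Proof. by move=> a b d; apply: cfunP => x /=; exact: mulrDl. Qed.
HB.instance Definition _ := GRing.Zmodule_isComPzRing.Build A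
  cfun_mulA cfun_mulC cfun_mul1 cfun_mulDl.

Fact cfun_scaleA (c d : C) a : cscale c (cscale d a) = cscale (c * d) a.
Proof. by apply: cfunP => x /=; exact: mulrA. Qed.
Fact cfun_scale1 : left_id 1 cscale.
Proof. by move=> a; apply: cfunP => x /=; exact: mul1r. Qed.
Fact cfun_scaleDr : right_distributive cscale +%R.
Proof. by move=> c a b; apply: cfunP => x /=; exact: mulrDr. Qed.
Fact cfun_scaleDl a : {morph cscale^~ a : c d / c + d}.
Proof. by move=> c d; apply: cfunP => x /=; exact: mulrDl. Qed.
HB.instance Definition _ := GRing.Zmodule_isLmodule.Build C A
  cfun_scaleA cfun_scale1 cfun_scaleDr cfun_scaleDl.

Fact cfun_scaleAl c a b : (c *: a) * b = c *: (a * b).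
Proof. by apply: cfunP => x /=; symmetry; exact: mulrA. Qed.
Fact cfun_scaleAr c a b : a * (c *: b) = c *: (a * b).
Proof. by apply: cfunP => x /=; exact: mulrCA. Qed.
Fact cfun_starK : involutive cstar.
Proof. by move=> a; apply: cfunP => x /=; exact: conjCK. Qed.
Fact cfun_starD : {morph cstar : a b / a + b}.
Proof. by move=> a b; apply: cfunP => x /=; exact: rmorphD. Qed.
Fact cfun_starZ c a : cstar (c *: a) = c^* *: cstar a.
Proof. by apply: cfunP => x /=; exact: rmorphM. Qed.
Fact cfun_starM a b : cstar (a * b) = cstar b * cstar a.
Proof. by rewrite mulrC; apply: cfunP => x /=; exact: rmorphM. Qed.
HB.instance Definition _ := isStarAlgebra.Build R A
  (@mulrA A) (@mul1r A) (@mulr1 A) (@mulrDl A) (@mulrDr A)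
  cfun_scaleAl cfun_scaleAr cfun_starK cfun_starD cfun_starZ cfun_starM.

Lemma cfun0E x : (0 : A) x = 0. Proof. by []. Qed.
Lemma cfunDE a b x : (a + b) x = a x + b x. Proof. by []. Qed.
Lemma cfunNE a x : (- a) x = - a x. Proof. by []. Qed.
Lemma cfun1E x : (1 : A) x = 1. Proof. by []. Qed.
Lemma cfunME a b x : (a * b) x = a x * b x. Proof. by []. Qed.
Lemma cfunZE c a x : (c *: a) x = c * a x. Proof. by []. Qed.
Lemma cfun_starE a x : (star a) x = (a x)^*. Proof. by []. Qed.

End cfun_algebra.

Section star_algebras.
Context {R : realType}.
Implicit Types A B : starAlgType R.

Definition positive_elt B (x : B) : Prop := exists y : B, x = star y * y.

Definition positive_map A B (f : A -> B) : Prop :=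
  forall x, positive_elt x -> positive_elt (f x).

Definition is_state B (phi : B -> Cx R) : Prop :=
  [/\ scalar phi, forall x, positive_elt x -> 0 <= phi x & phi 1 = 1].

Record star_hom A B (f : A -> B) : Prop := StarHom {
  star_hom_linear : linear f;
  star_hom1 : f 1 = 1;
  star_homM : {morph f : x y / x * y};
  star_hom_star : {morph f : x / star x}
}.

Definition is_projection B (p : B) : Prop := star p = p /\ p * p = p.

End star_algebras.

(* The element of [C(X)] with underlying function [f], which is continuous in
   all the uses below ([fcalc_continuous], [cdiv_continuous] and
   [transfer_continuous]); 0 otherwise. *)
HB.lock Definition cfun_of (R : realType) (X : topologicalType)
    (f : X -> Cx R) : cfun R X :=
  if pselect (continuous f) is left cf then mkcts cf else 0.

Section function_calculus.
Context {R : realType} {X : topologicalType}.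
Local Notation C := (Cx R).
Local Notation A := (cfun R X).
Implicit Types (a b : A).

Definition strictly_positive a : Prop := forall x, 0 < a x.

Lemma cfun_ofE (f : X -> C) : continuous f -> cfun_of f = f :> (X -> C).
Proof. by rewrite cfun_of.unlock; case: pselect. Qed.

(* The composite [g \o a], meant for [a] strictly positive, that is, with
   values in the positive real numbers. *)
Definition fcalc (g : R -> C) a : A := cfun_of (fun x => g (ReC (a x))).

Lemma fcalc_continuous (g : R -> C) a :
  (forall r, 0 < r -> {for r, continuous g}) -> strictly_positive a ->
  continuous (fun x => g (ReC (a x))).
Proof.
move=> cg a0 x.
apply: (@continuous_comp _ _ _ (fun x => ReC (a x)) g); last first.
  by apply: cg; have [] := ReC_gt0 (a0 x).
by apply: continuous_comp; [exact: cts_fun|exact: continuous_ReC].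
Qed.

Definition cln a : A := fcalc (fun r => ofR (ln r)) a.

(* The real power [a^s]. *)
Definition cpow a (s : R) : A := fcalc (fun r => ofR (r `^ s)) a.

(* The imaginary power [a^(it)], i.e. [exp (i * t * ln a)]. *)
Definition cipow a (t : R) : A :=
  fcalc (fun r => (cos (t * ln r) +i* sin (t * ln r))%C) a.

Definition cdiv a b : A := cfun_of (fun x => a x / b x).

Lemma cdiv_continuous a b :
  (forall x, b x != 0) -> continuous (fun x => a x / b x).
Proof.
by move=> b0 x; apply: cvgM; [exact: cts_fun|apply: cvgV => //; exact: cts_fun].
Qed.

Definition supnorm a : R := sup (range (fun x => ReC `|a x|)).

End function_calculus.

Definition local_homeo (X : topologicalType) (T : X -> X) : Prop :=
  forall x, exists2 U : set X, open U /\ U x &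
    [/\ open (T @` U), {within U, continuous T} &
        exists2 g : X -> X, {within T @` U, continuous g} &
          forall y, U y -> g (T y) = y].

Lemma cfun_positiveP {R : realType} {X : topologicalType} (a : cfun R X) :
  positive_elt a <-> forall x, 0 <= a x.
Proof.
split=> [[b ->] x|a0].
  by rewrite cfunME cfun_starE mulrC mul_conjC_ge0.
have cs : continuous (fun x => ofR (Num.sqrt (ReC (a x)))).
  move=> x; apply: continuous_comp; last exact: continuous_ofR.
  apply: (@continuous_comp _ _ _ (fun x => ReC (a x)) Num.sqrt).
    by apply: continuous_comp; [exact: cts_fun|exact: continuous_ReC].
  exact: sqrt_continuous.
pose b : cfun R X := mkcts cs; exists b; apply: cfunP => x.
have [ax0 axE] := ReC_ge0 (a0 x).
have bx : b x = ofR (Num.sqrt (ReC (a x))) by [].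
by rewrite cfunME cfun_starE bx conjC_ofR -ofRM -expr2 sqr_sqrtr.
Qed.

Section transfer_continuity.
Context {R : realType} {X : topologicalType} (T : continuousType X X)
  (cptX : compact [set: X]) (hX : hausdorff_space X) (lhT : local_homeo T).

Let local_inverse (y : X) : exists U : set X, exists g : X -> X,
  [/\ open U, U y, forall z, U z -> g (T z) = z, open (T @` U) &
      {in T @` U, continuous g}].
Proof.
have [U [oU Uy] [oTU _ [g cg gK]]] := lhT y.
by exists U, g; split => //; rewrite -continuous_open_subspace.
Qed.

Lemma fibre_finite (x : X) : finite_set (T @^-1` [set x]).
Proof.
have clF : closed (T @^-1` [set x]).
  apply: preimage_closed; first by move=> y _; exact: cts_fun.
  exact/accessible_closed_set1/hausdorff_accessible.
have cptF : compact (T @^-1` [set x]).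
  exact: (subclosed_compact clF cptX).
pose G : set_system {fset X} :=
  filter_from [set: {fset X}] (fun D : {fset X} => [set D' : {fset X} | [set` D] `<=` [set` D']]).
have GF : Filter G.
  apply: filter_from_filter; first by exists fset0.
  move=> D1 D2 _ _; exists (D1 `|` D2)%fset => // D' /= sD.
  by split=> z zD; apply: sD; rewrite /= inE; apply/orP; [left|right].
move/compact_near_coveringP/near_covering_withinP: cptF.
move=> /(_ {fset X} G (fun (D : {fset X}) z => z \in D) GF).
case.
  move=> y Fy; have [U [g [oU Uy gK _ _]]] := local_inverse y.
  exists (U, [set D : {fset X} | y \in D]) => /=.
    split; first by apply: open_nbhs_nbhs.
    by exists [fset y]%fset => // D /= sD; apply: sD; rewrite /= inE.
  move=> [z D] [/= Uz yD] Fz.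
  by rewrite -(gK _ Uz) Fz -Fy gK.
move=> D _ sD; apply: (@sub_finite_set _ _ [set` D]); last exact: finite_fset.
by apply: (sD D).
Qed.

Lemma transfer_continuous (f : X -> Cx R) : continuous f ->
  continuous (fun x => \sum_(y \in T @^-1` [set x]) f y).
Proof.
move=> cf x0; set F := T @^-1` [set x0].
have finF : finite_set F by exact: fibre_finite.
have [U /choice[g UgP]] := choice local_inverse.
have gx0 y : F y -> g y x0 = y.
  by move=> Fy; have [_ Uy gK _ _] := UgP y; rewrite -[x0]Fy gK.
have cg y : F y -> g y x @[x --> x0] --> y.
  move=> Fy; have [_ Uy gK _ cgy] := UgP y.
  rewrite -[X in _ --> X](gx0 _ Fy); apply: cgy.
  by apply: mem_set; exists y.
have nearF (P : X -> X -> Prop) : (forall y, F y -> \forall x \near x0, P y x) ->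
    \forall x \near x0, forall y, F y -> P y x.
  move=> FP.
  have h : nbhs x0 (\bigcap_(y in [set` fset_set F]) P y).
    by apply: filter_bigI => y; rewrite in_fset_set// inE => /FP.
  apply: (filterS _ h) => x /= hx y Fy; apply: hx.
  by rewrite /= in_fset_set// inE.
have near_TU : \forall x \near x0, forall y, F y -> (T @` U y) x.
  apply: (nearF _ _) => y Fy; apply: open_nbhs_nbhs; have [_ Uy _ oTU _] := UgP y.
  by split => //; exists y.
have near_inj : \forall x \near x0, forall y, F y -> forall y', F y' ->
    y != y' -> g y x != g y' x.
  apply: (nearF _ _) => y Fy; apply: (nearF _ _) => y' Fy'.
  have [->|yy'] := eqVneq y y'; first by apply: nearW => x; rewrite eqxx.
  move: hX; rewrite open_hausdorff => /(_ _ _ yy')[[V W] /= [yV y'W]].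
  move=> [oV oW /eqP VW].
  have nV : \forall x \near x0, V (g y x).
    by apply: (cg _ Fy); apply: open_nbhs_nbhs; split => //; rewrite -inE.
  have nW : \forall x \near x0, W (g y' x).
    by apply: (cg _ Fy'); apply: open_nbhs_nbhs; split => //; rewrite -inE.
  apply: filterS2 nV nW => x Vx Wx _; apply/eqP => gg.
  have : (V `&` W) (g y x) by split => //; rewrite gg.
  by rewrite VW.
pose K := ~` \bigcup_(y in F) U y.
have near_surj : \forall x \near x0, ~ (T @` K) x.
  have oK : open (\bigcup_(y in F) U y).
    by apply: bigcup_open => y _; have [] := UgP y.
  have cK : compact K by apply: (subclosed_compact _ cptX) => //; exact: open_closedC.
  have cTK : closed (T @` K).
    apply: compact_closed => //; apply: continuous_compact => //.
    by apply: continuous_subspaceT; exact: cts_fun.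
  apply: (@open_nbhs_nbhs _ x0 (~` (T @` K))); split; first exact: closed_openC.
  by move=> [y Ky Fy]; apply: Ky; exists y => //; have [] := UgP y.
have sumE : \forall x \near x0, \sum_(y <- fset_set F) f (g y x) =
    \sum_(y \in T @^-1` [set x]) f y.
  apply: filterS3 near_TU near_inj near_surj => x xTU xinj xsurj.
  rewrite -fsbig_finite//; symmetry; apply: reindex_fsbig; split.
  - move=> y Fy /=; have [z Uz <-] := xTU _ Fy; have [_ _ gK _ _] := UgP y.
    by rewrite gK.
  - move=> y y'; rewrite !inE => Fy Fy' gg; apply/eqP.
    by apply: contraT => /(xinj _ Fy _ Fy'); rewrite gg eqxx.
  - move=> z /= Tz.
    have : (\bigcup_(y in F) U y) z by apply: contrapT => Kz; apply: xsurj; exists z.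
    move=> [y Fy Uz]; exists y => //.
    by have [_ _ gK _ _] := UgP y; rewrite -Tz gK.
rewrite /continuous_at -/F [X in _ --> X]fsbig_finite//.
apply: cvg_trans; first exact: (near_eq_cvg sumE).
rewrite big_seq; under eq_fun do rewrite big_seq.
apply: cvg_big => [|y]; first exact: add_continuous.
rewrite in_fset_set// inE => Fy.
by apply: (cvg_comp _ _ (cg _ Fy)); exact: cf.
Qed.

End transfer_continuity.

Section dynamics.
Context {R : realType} {X : topologicalType}.
Local Notation C := (Cx R).
Local Notation A := (cfun R X).
Context (T : continuousType X X).
Implicit Types (a b h rho : A) (L E : A -> A).

Definition alpha a : A := a \o T.

Definition transfer_operator L : Prop :=
  [/\ linear L, positive_map L & forall a b, L (alpha a * b) = a * L b].

Definition normalized L : Prop := L 1 = 1.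

Definition quasi_basis E m (u : 'I_m -> A) : Prop :=
  forall a, a = \sum_(i < m) u i * E (star (u i) * a).

Definition finite_index E : Prop := exists m (u : 'I_m -> A), quasi_basis E u.

(* [ind E] does not depend on the family it is computed from. *)
Definition ind E : A :=
  xget 1 [set c | exists m (u : 'I_m -> A),
                    quasi_basis E u /\ c = \sum_(i < m) u i * star (u i)].

Definition cocycle h n : A := \prod_(i < n) iter i alpha h.

(* The fibres of a local homeomorphism of a compact space are finite. *)
Definition Lop rho a : A :=
  cfun_of (fun x => \sum_(y \in T @^-1` [set x]) rho y * a y).

Definition invariant_state (phi : A -> C) : Prop :=
  is_state phi /\ phi \o alpha = phi.

(* [phi] takes real values on real functions, which is why real parts
   are taken. *)
Definition Ent (rho0 : A) (phi : A -> C) : \bar R :=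
  ereal_inf [set (ReC (phi (cln (cdiv (Lop rho0 a) (rho0 * a)))))%:E
            | a in [set a | strictly_positive a]].

Definition free_energy (rho0 b : A) (phi : A -> C) : \bar R :=
  (Ent rho0 phi + (ReC (phi (cln b)))%:E)%E.

Definition pressure (rho0 b : A) : \bar R :=
  ereal_sup [set free_energy rho0 b phi | phi in invariant_state].

Definition equilibrium_state (rho0 b : A) (phi : A -> C) : Prop :=
  invariant_state phi /\ free_energy rho0 b phi = pressure rho0 b.

End dynamics.

Lemma cfun_of_ext {R : realType} {X : topologicalType} (f g : X -> Cx R) :
  f =1 g -> cfun_of f = cfun_of g.
Proof. by move=> /funext ->. Qed.

Lemma Ent_indep {R : realType} {X : topologicalType} (T : continuousType X X)
    (rho0 rho1 : cfun R X) (phi : cfun R X -> Cx R) :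
  strictly_positive rho0 -> strictly_positive rho1 ->
  Ent T rho0 phi = Ent T rho1 phi.
Proof.
have sub (r s : cfun R X) : strictly_positive r -> strictly_positive s ->
    forall a, strictly_positive a -> exists2 b, strictly_positive b &
      cdiv (Lop T s b) (s * b) = cdiv (Lop T r a) (r * a).
  move=> r0 s0 a a0.
  have s_neq0 x : s x != 0 by rewrite lt0r_neq0.
  have bE x : cdiv (r * a) s x = r x * a x / s x.
    by rewrite cfun_ofE; [|exact: cdiv_continuous].
  have sb : s * cdiv (r * a) s = r * a.
    by apply: cfunP => x; rewrite cfunME bE mulrC divfK.
  exists (cdiv (r * a) s).
    by move=> x; rewrite bE; apply: mulr_gt0; [exact: mulr_gt0|rewrite invr_gt0].
  rewrite sb; apply: (congr1 (fun d => cdiv d (r * a))).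
  apply: cfun_of_ext => x; apply: eq_fsbigr => y _.
  by rewrite -!cfunME sb.
move=> rho0_gt0 rho1_gt0; apply: (congr1 (@ereal_inf R)).
apply/seteqP; split=> _ [a a0 <-].
  by have [b b0 E] := sub _ _ rho0_gt0 rho1_gt0 _ a0; exists b => //; rewrite E.
by have [b b0 E] := sub _ _ rho1_gt0 rho0_gt0 _ a0; exists b => //; rewrite E.
Qed.

Section exel_renault_algebra.
Context {R : realType} {X : topologicalType}.
Local Notation C := (Cx R).
Local Notation A := (cfun R X).
Context (T : continuousType X X) (L : A -> A).

Definition Eop n : A -> A := iter n (alpha T) \o iter n L.

Record toeplitz_relations (B : cstarAlgType R) (j : A -> B) (f : nat -> B)
    : Prop := ToeplitzRelations {
  toeplitz_hom : star_hom j;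
  toeplitz_proj : forall n, is_projection (f n);
  toeplitz0 : f 0%N = 1;
  toeplitzS : forall n, f n.+1 * f n = f n.+1;
  toeplitzE : forall n a, f n * j a * f n = j (Eop n a) * f n
}.

(* [B], [j], [f] is the universal unital C*-algebra [T(R,E)]; uniqueness in the
   universal property says that [B] is generated by [j] and [f]. *)
Definition is_toeplitz_algebra (B : cstarAlgType R) (j : A -> B)
    (f : nat -> B) : Prop :=
  toeplitz_relations j f /\
  forall (D : cstarAlgType R) (j' : A -> D) (f' : nat -> D),
    toeplitz_relations j' f' ->
    exists! pi : B -> D, [/\ star_hom pi, forall a, pi (j a) = j' a &
                             forall n, pi (f n) = f' n].

Section redundancies.
Context (B : cstarAlgType R) (j : A -> B) (f : nat -> B).

Definition linear_span (S : set B) : set B :=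
  [set x | exists m (c : 'I_m -> C) (s : 'I_m -> B),
     (forall i, S (s i)) /\ x = \sum_(i < m) c i *: s i].

Definition Khat n : set B :=
  closure (linear_span [set j ab.1 * f n * j ab.2 | ab in [set: A * A]]).

Definition redundancy n (a : 'I_n.+1 -> B) : Prop :=
  (forall i : 'I_n.+1, Khat i (a i)) /\
  (forall x, Khat n x -> \sum_(i < n.+1) a i * x = 0).

Definition redundancy_sums : set B :=
  [set s | exists n (a : 'I_n.+1 -> B), redundancy a /\ s = \sum_i a i].

Record closed_ideal (J : set B) : Prop := ClosedIdeal {
  closed_ideal_closed : closed J;
  closed_ideal0 : J 0;
  closed_idealD : forall x y, J x -> J y -> J (x + y);
  closed_idealZ : forall (c : C) x, J x -> J (c *: x);
  closed_idealMl : forall x y, J y -> J (x * y);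
  closed_idealMr : forall x y, J x -> J (x * y)
}.

Definition generated_ideal (S : set B) : set B :=
  [set x | forall J, closed_ideal J -> S `<=` J -> J x].

Definition redundancy_ideal : set B := generated_ideal redundancy_sums.

End redundancies.

(* Up to isomorphism, the quotients of a C*-algebra by a closed ideal [J] are
   the surjective *-homomorphisms with kernel [J]. *)
Definition is_quotient (B D : cstarAlgType R) (J : set B) (q : B -> D) : Prop :=
  [/\ star_hom q, range q = [set: D] & forall x, q x = 0 <-> J x].

Record canonical_expectation (B : cstarAlgType R) (j : A -> B) (f : nat -> B)
    (G : B -> A) : Prop := CanonicalExpectation {
  expectation_linear : linear G;
  expectation_pos : positive_map G;
  expectation_contractive : forall x y, `|G x y| <= `|x|;
  expectation_id : forall a, G (j a) = a;
  expectation_bimod : forall a b x, G (j a * x * j b) = a * G x * b;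
  expectationE : forall a b n,
    G (j a * f n * j b) =
    a * cdiv 1 (cocycle T (ind (alpha T \o L)) n) * b
}.

(* A strongly continuous one-parameter group of *-automorphisms with the
   prescribed values on the generators; the group law makes each [sigma t]
   bijective. *)
Record is_dynamics (B : cstarAlgType R) (j : A -> B) (f : nat -> B) (h : A)
    (sigma : R -> B -> B) : Prop := IsDynamics {
  dynamics_hom : forall t, star_hom (sigma t);
  dynamics0 : forall x, sigma 0 x = x;
  dynamicsD : forall s t x, sigma (s + t) x = sigma s (sigma t x);
  dynamics_continuous : forall x, continuous (fun t => sigma t x);
  dynamics_fun : forall t a, sigma t (j a) = j a;
  dynamics_proj : forall t n,
    sigma t (f n) = j (cipow (cocycle T h n) t) * f n *
                    j (cipow (cocycle T h n) (- t))
}.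

End exel_renault_algebra.

Section kms.
Context {R : realType} {B : cstarAlgType R}.
Local Notation C := (Cx R).

Definition entire (F : C -> B) : Prop := forall z : C, derivable F z 1.

(* [F] is the entire extension of [t |-> sigma t x]. *)
Definition analytic_extension (sigma : R -> B -> B) (x : B) (F : C -> B) :=
  entire F /\ forall t : R, F (ofR t) = sigma t x.

Definition kms_state (sigma : R -> B -> B) (beta : R) (psi : B -> C) : Prop :=
  is_state psi /\
  forall (x y : B) (F : C -> B), analytic_extension sigma x F ->
    psi (x * y) = psi (y * F ('i * ofR beta)).

End kms.

(* Main.v *)
Require Import Defs.
From mathcomp Require Import all_boot all_order all_algebra.
From mathcomp Require Import all_classical all_reals all_analysis.
From mathcomp Require Import finmap complex.
Import Order.TTheory GRing.Theory Num.Theory.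
Import numFieldNormedType.Exports.
Local Open Scope classical_set_scope.
Local Open Scope ring_scope.

(* The potential [rho'] is normalized, so its transfer operator [L'] fixes 1 and
   averages over the fibres of [T]. The test function 1 in the entropy gives
   [Ent mu + mu (ln rho') <= 0] for every state [mu]. The convergence of [L'^n]
   makes [phi'] invariant under [L'], hence under [alpha]; Jensen's inequality
   [L' (ln a) <= ln (L' a)] then gives [Ent phi' + phi' (ln rho') >= 0]. *)

(** * Pointwise values of functional calculus, and the supremum norm *)

Section values.
Context {R : realType} {X : topologicalType}.
Implicit Types (a b : cfun R X) (z : Cx R).

Lemma ReCD y z : ReC (y + z) = ReC y + ReC z.
Proof. by case: y z => [a b] [c d]. Qed.

Lemma ReC_le y z : y <= z -> ReC y <= ReC z.
Proof. by rewrite -subr_ge0 => /ReC_ge0[+ _]; rewrite ReCB subr_ge0. Qed.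

Lemma ofR_gt0 (r : R) : 0 < r -> 0 < ofR r.
Proof. by move=> r0; rewrite /ofR ltcR. Qed.

Lemma ofR_ReC_norm z : ofR (ReC `|z|) = `|z|.
Proof. by have [_ <-] := ReC_ge0 (normr_ge0 z). Qed.

(** Positivity keeps [ReC (a x)] where [ln] is continuous, so [cfun_of] does not return its default
    0. *)
Lemma clnE a x : strictly_positive a -> cln a x = ofR (ln (ReC (a x))).
Proof.
move=> a0; rewrite /cln /fcalc cfun_ofE //.
apply: (fcalc_continuous (g := fun r => ofR (ln r))) => // r r0.
by apply: (@continuous_comp _ _ _ (@ln R) ofR);
  [exact: continuous_ln|exact: continuous_ofR].
Qed.

Lemma cpow_gt0 a (s : R) : strictly_positive a -> strictly_positive (cpow a s).
Proof.
move=> a0 x; rewrite /cpow /fcalc cfun_ofE.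
  by apply: ofR_gt0; rewrite powR_gt0//; have [] := ReC_gt0 (a0 x).
apply: (fcalc_continuous (g := fun r => ofR (r `^ s))) => // r r0.
apply: (@continuous_comp _ _ _ (fun r => r `^ s) ofR);
  last exact: continuous_ofR.
apply/differentiable_continuous/derivable1_diffP/derivable_powR.
by rewrite in_itv /= r0.
Qed.

Lemma cdivE a b x : (forall y, b y != 0) -> cdiv a b x = a x / b x.
Proof. by move=> b0; rewrite /cdiv cfun_ofE //; exact: cdiv_continuous. Qed.

Lemma cdiv_gt0 a b : strictly_positive a -> strictly_positive b ->
  strictly_positive (cdiv a b).
Proof.
move=> a0 b0 x; rewrite cdivE => [|y]; last exact: lt0r_neq0.
exact: divr_gt0.
Qed.

Lemma cfun_gt0M a b : strictly_positive a -> strictly_positive b ->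
  strictly_positive (a * b).
Proof. by move=> a0 b0 x; rewrite cfunME mulr_gt0. Qed.

(** Compactness bounds the range of the modulus, so [sup] is a true supremum rather than its default
    value. *)
Lemma supnorm_ub a x : compact [set: X] -> ReC `|a x| <= supnorm a.
Proof.
move=> cX; apply: ub_le_sup; last by exists x.
suff [] : has_sup (range (fun x => ReC `|a x|)) by [].
apply: compact_has_sup; first by exists (ReC `|a x|), x.
apply: continuous_compact => //; apply: continuous_subspaceT => y.
apply: (@continuous_comp _ _ _ (fun y => `|a y|) ReC);
  last exact: continuous_ReC.
apply: (@continuous_comp _ _ _ a (fun z : Cx R => `|z|));
  [exact: cts_fun|exact: norm_continuous].
Qed.

End values.

(** * Jensen's inequality for [ln] and finite weighted means *)

Section jensen.
Context {R : realType} {I : eqType} (s : seq I) (w a : I -> Cx R).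
Hypotheses (w0 : forall i, 0 < w i) (a0 : forall i, 0 < a i)
  (w1 : \sum_(i <- s) w i = 1).

Lemma weighted_mean_gt0 : 0 < \sum_(i <- s) w i * a i.
Proof.
have ge0 i : true -> 0 <= w i * a i by move=> _; rewrite mulr_ge0 ?ltW.
rewrite lt_neqAle sumr_ge0 // andbT eq_sym psumr_neq0 //.
(* The list is nonempty, since an empty sum of weights would be 0; one positive term then
   suffices. *)
case: s w1 => [|i t _]; first by rewrite big_nil => /esym/eqP; rewrite oner_eq0.
by rewrite /= mulr_gt0.
Qed.

(** By concavity [ln] lies below its tangent at the mean [m]; averaged with weights of sum 1, the
    linear terms [a i / m - 1] cancel and [ln m] remains. *)
Lemma weighted_mean_ln :
  \sum_(i <- s) w i * ofR (ln (ReC (a i))) <=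
  ofR (ln (ReC (\sum_(i <- s) w i * a i))).
Proof.
have := weighted_mean_gt0; set m := \sum_(i <- s) _ => m_gt0.
have [m0 mE] := ReC_gt0 m_gt0.
(* tangent line of [ln] at the mean *)
have tangent i : ofR (ln (ReC (a i))) <= ofR (ln (ReC m)) + a i / m - 1.
  have [ai0 aiE] := ReC_gt0 (a0 i).
  rewrite {2}aiE {2}mE /ofR -fmorphV -!rmorphM -(rmorph1 (real_complex R)).
  rewrite -!rmorphD -!rmorphB lecR -addrA -lerBlDl -ln_div ?posrE //.
  (* Division by the mean reduces the bound to [ln q <= q - 1] for [q > 0]. *)
  have q0 : 0 < ReC (a i) / ReC m by rewrite divr_gt0.
  rewrite -{1}[ReC (a i) / _](subrKC 1); apply: le_ln1Dx.
  by rewrite ltrBrDl subrr.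
apply: (@le_trans _ _
    (\sum_(i <- s) w i * (ofR (ln (ReC m)) + a i / m - 1))).
  by apply: ler_sum => i _; rewrite ler_pM2l.
rewrite (eq_bigr (fun i => w i * (ofR (ln (ReC m)) - 1) + w i * a i / m)).
  rewrite big_split /= -!mulr_suml w1 mul1r -/m divff ?lt0r_neq0 //.
  by rewrite subrK.
by move=> i _; rewrite -addrA [a i / m - 1]addrC addrA mulrDr mulrA.
Qed.

End jensen.

(** * Transfer operators as finite sums over fibres *)

Section ruelle_operator.
Context {R : realType} {X : topologicalType} (T : continuousType X X).
Hypotheses (cX : compact [set: X]) (hX : hausdorff_space X) (lT : local_homeo T).
Local Notation A := (cfun R X).
Implicit Types (w a b : A) (phi : A -> Cx R).

(** The list depends on [x] alone, so sums for different weights and functions can be compared term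
    by term. *)
Lemma LopE x : exists s : seq X, (forall y, y \in s -> T y = x) /\
  forall w a, Lop T w a x = \sum_(y <- s) w y * a y.
Proof.
have fin := fibre_finite cX hX lT x.
exists (fset_set (T @^-1` [set x])); split=> [y|w a].
  by rewrite in_fset_set // => /set_mem.
rewrite /Lop cfun_ofE ?fsbig_finite //.
apply: (transfer_continuous cX hX lT (f := fun y => w y * a y)).
by move=> y; apply: cvgM; exact: cts_fun.
Qed.

Lemma Lop_alphaM w a b : Lop T w (alpha T a * b) = a * Lop T w b.
Proof.
apply: cfunP => x; have [s [sT LE]] := LopE x.
rewrite cfunME !LE mulr_sumr; apply: eq_big_seq => y ys.
by rewrite cfunME mulrCA /alpha /= sT.
Qed.

(** On the fibre over [x] the function [alpha T k] is constant equal to [k x]; it leaves the sum,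
    and the eigenvalue equation turns the rest into 1. *)
Lemma Lop_eigen_normalized w k (lambda : R) :
  strictly_positive k -> 0 < lambda -> Lop T w k = ofR lambda *: k ->
  Lop T (cdiv (w * k) (ofR lambda *: alpha T k)) 1 = 1.
Proof.
move=> k0 /ofR_gt0 l0 Lk; apply: cfunP => x; have [s [sT LE]] := LopE x.
have lk0 y : (ofR lambda *: alpha T k) y != 0.
  by rewrite cfunZE mulf_neq0 ?lt0r_neq0 //; exact: k0.
rewrite LE (eq_big_seq (fun y => w y * k y / (ofR lambda * k x))) => [|y ys].
  rewrite -mulr_suml -LE Lk cfunZE divff //.
  by rewrite mulf_neq0 ?lt0r_neq0.
by rewrite mulr1 cdivE // cfunME cfunZE /alpha /= sT.
Qed.

Lemma Lop_gt0 w a : strictly_positive w -> Lop T w 1 = 1 ->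
  strictly_positive a -> strictly_positive (Lop T w a).
Proof.
move=> w0 w1 a0 x; have [s [_ LE]] := LopE x.
rewrite LE; apply: weighted_mean_gt0 => //.
rewrite -(cfun1E x) -w1 LE.
by apply: eq_bigr => y _; rewrite mulr1.
Qed.

Lemma Lop_ln w a x : strictly_positive w -> Lop T w 1 = 1 ->
  strictly_positive a -> Lop T w (cln a) x <= cln (Lop T w a) x.
Proof.
move=> w0 w1 a0; rewrite clnE; last exact: Lop_gt0.
have [s [_ LE]] := LopE x; rewrite !LE.
under eq_bigr do rewrite clnE //.
apply: weighted_mean_ln => //.
rewrite -(cfun1E x) -w1 LE.
by apply: eq_bigr => y _; rewrite mulr1.
Qed.

(** The iterates of [L a] are those of [a] shifted by one, so their limits [phi (L a)] and [phi a]
    agree. The point [x] turns norm convergence into convergence of scalars. *)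
Lemma Lop_limit_invariant w phi (x : X) :
  (forall a, supnorm (iter n (Lop T w) a - phi a *: (1 : A)) @[n --> \oo]
     --> (0 : R)) ->
  forall a, phi (Lop T w a) = phi a.
Proof.
move=> lim a; set L := Lop T w.
pose u b n := supnorm (iter n L b - phi b *: (1 : A)).
have dist b n : ReC `|iter n L b x - phi b| <= u b n.
  have := supnorm_ub (iter n L b - phi b *: (1 : A)) x cX.
  by rewrite cfunDE cfunNE cfunZE cfun1E mulr1.
apply/eqP; rewrite -subr_eq0 -normr_le0 -ofR_ReC_norm.
have -> : (0 : Cx R) = ofR 0 by [].
rewrite /ofR lecR.
(* Both errors are measured from the common value [iter n.+1 L a x], hence the index [n.+1] for
   [a]. *)
have l0 : u (L a) n + u a n.+1 @[n --> \oo] --> (0 : R).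
  rewrite -[X in _ --> X](addr0 0); apply: cvgD; first exact: lim.
  by have := lim a; rewrite -cvg_shiftS.
apply: (ler_cvg_to (cvg_cst _) l0); apply: nearW => n.
have := lerD (dist (L a) n) (dist a n.+1).
apply: le_trans; rewrite -ReCD; apply: ReC_le.
by rewrite iterSr [X in _ <= X + _]distrC; exact: ler_distD.
Qed.

End ruelle_operator.

(** * Monotonicity of states and multiplication by a density *)

Section states.
Context {R : realType} {X : topologicalType}.
Local Notation A := (cfun R X).
Implicit Types (a b : A) (phi : A -> Cx R).

Lemma scalarD phi a b : scalar phi -> phi (a + b) = phi a + phi b.
Proof. by move=> lin; have := lin 1 a b; rewrite scale1r /= mul1r. Qed.

Lemma scalarB phi a b : scalar phi -> phi (a - b) = phi a - phi b.
Proof.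
move=> lin; have := lin (-1) b a.
by rewrite scaleN1r /= mulN1r [a - b]addrC [RHS]addrC.
Qed.

Lemma state_le phi a b : is_state phi -> (forall x, a x <= b x) ->
  ReC (phi a) <= ReC (phi b).
Proof.
move=> [lin pos _] ab; apply: ReC_le; rewrite -subr_ge0 -scalarB //.
apply: pos; apply/cfun_positiveP => x.
by rewrite cfunDE cfunNE subr_ge0.
Qed.

Lemma state_mul phi k : is_state phi -> strictly_positive k -> phi k = 1 ->
  is_state (fun a => phi (k * a)).
Proof.
move=> [lin pos _] k0 k1; split; last by rewrite mulr1.
  by move=> c a b; rewrite mulrDr cfun_scaleAr; exact: lin.
move=> a /cfun_positiveP a0; apply: pos; apply/cfun_positiveP => x.
by rewrite cfunME mulr_ge0 // ltW.
Qed.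

End states.

(** * Entropy and pressure for a normalized potential *)

Section normalized_potential.
Context {R : realType} {X : topologicalType} (T : continuousType X X).
Hypotheses (cX : compact [set: X]) (hX : hausdorff_space X) (lT : local_homeo T).
Local Notation A := (cfun R X).
Context (w : A) (w0 : strictly_positive w) (w1 : Lop T w 1 = 1).

(** With [w] itself as reference function of the entropy, the term [cln w] of the free energy
    cancels the one in the integrand, leaving [cln (Lop T w a) - cln a]. *)
Lemma cln_quotientD (a : A) : strictly_positive a ->
  cln (cdiv (Lop T w a) (w * a)) + cln w + cln a = cln (Lop T w a).
Proof.
move=> a0; have La0 := Lop_gt0 T cX hX lT w a w0 w1 a0.
have wa0 := cfun_gt0M w a w0 a0.
apply: cfunP => x; rewrite !cfunDE !clnE //; last exact: cdiv_gt0.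
rewrite cdivE => [|y]; last exact: lt0r_neq0.
have [L0 LE] := ReC_gt0 (La0 x); have [W0 WE] := ReC_gt0 (w0 x).
have [A0 AE] := ReC_gt0 (a0 x).
rewrite cfunME LE WE AE -ofRM /ofR -fmorphV -rmorphM -!rmorphD /ReC /=.
by rewrite ln_div ?lnM ?posrE ?mulr_gt0 // -addrA subrK.
Qed.

(** The test function 1 gives the integrand [- cln w], because [Lop T w 1 = 1]. *)
Lemma free_energy_le0 (phi : A -> Cx R) : is_state phi ->
  (free_energy T w w phi <= 0)%E.
Proof.
move=> [lin pos u1]; rewrite /free_energy.
have one0 : strictly_positive (1 : A) by move=> x; rewrite cfun1E ltr01.
have := cln_quotientD 1 one0; rewrite w1 => q0.
have l1 : cln (1 : A) = 0.
  by apply: cfunP => x; rewrite clnE // cfun1E /ReC /= ln1.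
rewrite l1 addr0 in q0.
have p0 : phi 0 = 0 by rewrite -(subrr (0 : A)) scalarB // subrr.
apply: (@le_trans _ _
  ((ReC (phi (cln (cdiv (Lop T w 1) (w * 1)))))%:E + (ReC (phi (cln w)))%:E)%E).
  by rewrite leeD2r //; apply: ereal_inf_lbound; exists 1.
by rewrite w1 -EFinD -ReCD -scalarD // q0 p0.
Qed.

(** Invariance replaces [phi (cln a)] by [phi (Lop T w (cln a))], which Jensen bounds by
    [phi (cln (Lop T w a))], for every test function [a]. *)
Lemma free_energy_ge0 (phi : A -> Cx R) : is_state phi ->
  (forall a, phi (Lop T w a) = phi a) -> (0 <= free_energy T w w phi)%E.
Proof.
move=> st inv; have [lin _ _] := st.
(* The finite term [phi (cln w)] moves across, so that a lower bound for the infimum is checked on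
   each [a]. *)
rewrite /free_energy -leeBlDr // sub0e; apply: le_ereal_inf_tmp => _ [a a0 <-].
have := state_le phi _ _ st (fun x => Lop_ln T cX hX lT w a x w0 w1 a0).
rewrite inv -cln_quotientD // !scalarD // !ReCD -{1}[ReC (phi (cln a))]add0r.
by rewrite lerD2r -EFinN lee_fin -subr_ge0 opprK.
Qed.

Lemma equilibrium_of_Lop_invariant (phi : A -> Cx R) : is_state phi ->
  (forall a, phi (Lop T w a) = phi a) -> equilibrium_state T w w phi.
Proof.
move=> st inv; have ast : invariant_state T phi.
  split=> //; apply/funext => a /=.
  (* Here [Lop T w] is a left inverse of [alpha T], since it fixes 1. *)
  by rewrite -inv -[alpha T a]mulr1 Lop_alphaM // w1 mulr1.
split=> //; apply/eqP; rewrite eq_le ereal_sup_ubound ?andTb; last by exists phi.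
apply: (@le_trans _ _ 0%E); last exact: free_energy_ge0.
by apply: ge_ereal_sup => _ [mu [mu_st _] <-]; exact: free_energy_le0.
Qed.

(** Passes from the convenient reference function [w] to an arbitrary positive one, in the free
    energy and in the pressure alike. *)
Lemma equilibrium_state_indep (rho0 : A) (phi : A -> Cx R) :
  strictly_positive rho0 -> equilibrium_state T w w phi ->
  equilibrium_state T rho0 w phi.
Proof.
move=> r0; have E mu : free_energy T rho0 w mu = free_energy T w w mu.
  by rewrite /free_energy (Ent_indep T mu r0 w0).
rewrite /equilibrium_state /pressure E => -[inv ->]; split=> //.
by congr ereal_sup; apply: eq_imagel => mu _; rewrite E.
Qed.

End normalized_potential.

Theorem proposition25 (R : realType) (X : topologicalType)
  (T : continuousType X X)
  (L : cfun R X -> cfun R X)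
  (TRE CRE : cstarAlgType R)
  (iota : cfun R X -> TRE) (e : nat -> TRE) (q : TRE -> CRE)
  (G : CRE -> cfun R X)
  (h : cfun R X) (beta : R) (sigma : R -> CRE -> CRE)
  (phi : cfun R X -> Cx R)
  (lambda : R) (k : cfun R X) (rho0 : cfun R X) :
  compact [set: X] -> hausdorff_space X ->
  local_homeo T ->
  injective (alpha T : cfun R X -> cfun R X) ->
  transfer_operator T L -> normalized L -> finite_index (alpha T \o L) ->
  (* CRE is C*(R,E), with generators q \o iota and q \o e *)
  is_toeplitz_algebra T L iota e ->
  is_quotient (redundancy_ideal iota e) q ->
  canonical_expectation T L (q \o iota) (q \o e) G ->
  strictly_positive h ->
  is_dynamics T (q \o iota) (q \o e) h sigma ->
  is_state phi ->
  kms_state sigma beta (phi \o G) ->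
  let rho := cpow h (- beta) in
  0 < lambda -> strictly_positive k ->
  Lop T rho k = ofR lambda *: k ->
  phi k = 1 ->
  let rho' := cdiv (rho * k) (ofR lambda *: alpha T k) in
  let phi' := fun a : cfun R X => phi (k * a) in
  (forall a : cfun R X,
     supnorm (iter n (Lop T rho') a - phi' a *: (1 : cfun R X)) @[n --> \oo] --> (0 : R)) ->
  strictly_positive rho0 ->
  equilibrium_state T rho0 rho' phi'.
Proof.
move=> cX hX lT _ _ _ _ _ _ _ h0 _ phi_st _ rho l0 k0 Lk phik rho' phi' lim r0.
have w0 : strictly_positive rho'.
  apply: cdiv_gt0; first by apply: cfun_gt0M => //; exact: cpow_gt0.
  by move=> x; rewrite cfunZE mulr_gt0 ?ofR_gt0 //; exact: k0.
have w1 : Lop T rho' 1 = 1 by exact: Lop_eigen_normalized.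
have st : is_state phi' by exact: state_mul.
have inv a : phi' (Lop T rho' a) = phi' a.
  (* The limit argument evaluates at a point; on an empty space any two functions are equal. *)
  have [[x _]|X0] := pselect (exists x : X, True).
    exact: (Lop_limit_invariant T cX rho' phi' x lim).
  by congr phi'; apply: cfunP => x; case: X0; exists x.
by apply: equilibrium_state_indep => //; exact: equilibrium_of_Lop_invariant.
Qed.
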